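(* Let $0<q<1$. For $\alpha\in\mathbb{N}$ the identity $$(q^{\mu+\beta};q)_{\alpha}\,{}_2\phi_1(q,0;q^{\mu+\alpha};x)\,{}_2\phi_1(q,0;q^{\mu+\beta};x)-(q^{\mu};q)_{\alpha}\,{}_2\phi_1(q,0;q^{\mu};x)\,{}_2\phi_1(q,0;q^{\mu+\alpha+\beta};x)$$ $$=\sum_{j=0}^{\alpha-1}\Bigl\{(q^{\mu+1+j};q)_{\alpha-1-j}\,(q^{\mu+\alpha+\beta-1-j};q)_{1+j}\,{}_2\phi_1(q,0;q^{\mu+1+j};x)$$ $$-(q^{\mu+j};q)_{\alpha-j}\,(q^{\mu+\alpha+\beta-j};q)_{j}\,{}_2\phi_1(q,0;q^{\mu+\alpha+\beta-j};x)\Bigr\}$$ holds for all values of the parameters $\mu,\beta,x$ for which both sides make sense.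
   Context: $\mathbb{N}=\{1,2,\dots\}$. The $q$-shifted factorial is $(a;q)_0=1$, $(a;q)_n=\prod_{k=0}^{n-1}(1-aq^k)$ for $n\ge1$. Heine's series is ${}_2\phi_1(a_1,a_2;b;x)=\sum_{n=0}^\infty\frac{(a_1;q)_n(a_2;q)_n}{(b;q)_n(q;q)_n}x^n$, $|x|<1$; in particular ${}_2\phi_1(q,0;b;x)=\sum_{n=0}^\infty\frac{x^n}{(b;q)_n}$, defined when $(b;q)_n\neq0$ for all $n$. *)

(* Defs.v *)
From Stdlib Require Export Reals.
From Coquelicot Require Export Coquelicot.
Open Scope C_scope.

(* The complex exponential, e^(u+iv) = e^u (cos v + i sin v). *)
Definition Cexp (z : C) : C :=
  ((exp (Re z) * cos (Im z))%R, (exp (Re z) * sin (Im z))%R).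

(* q^z for a positive real base (principal value, with the real logarithm). *)
Definition Rcpow (q : R) (z : C) : C := Cexp (z * ln q).

Fixpoint qpoch (a q : C) (n : nat) : C :=
  match n with
  | O => 1
  | S k => qpoch a q k * (1 - a * q ^ k)
  end.

(* Coquelicot's total [Series] is real-valued; a complex series converges iff
   its real and imaginary parts do, and its sum is taken componentwise. *)
Definition CSeries (a : nat -> C) : C :=
  (Series (fun n => Re (a n)), Series (fun n => Im (a n))).

Lemma is_CSeries_unique (a : nat -> C) (l : C) :
  is_series a l -> CSeries a = l.
Proof.
  intros H.
  assert (Hre : forall n, Re (sum_n a n) = sum_n (fun k => Re (a k)) n).
  { induction n as [|n IH]; [now rewrite !sum_O|].
    now rewrite !sum_Sn, <- IH. }
  assert (Him : forall n, Im (sum_n a n) = sum_n (fun k => Im (a k)) n).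
  { induction n as [|n IH]; [now rewrite !sum_O|].
    now rewrite !sum_Sn, <- IH. }
  destruct l as [u v]; unfold CSeries; f_equal; apply is_series_unique;
    intros P [e He].
  - destruct (H (fun z => ball u e (fst z))) as [N HN].
    { exists e; intros z [Hz _]; exact Hz. }
    exists N; intros n Hn; apply He; rewrite <- Hre; exact (HN n Hn).
  - destruct (H (fun z => ball v e (snd z))) as [N HN].
    { exists e; intros z [_ Hz]; exact Hz. }
    exists N; intros n Hn; apply He; rewrite <- Him; exact (HN n Hn).
Qed.

(* Heine's series 2phi1(a1, a2; b; x) with base q. *)
Definition phi21 (q a1 a2 b x : C) : C :=
  CSeries (fun n =>
    qpoch a1 q n * qpoch a2 q n / (qpoch b q n * qpoch q q n) * x ^ n).

(* Main.v *)
(* Write F(b) for the value of 2phi1(q, 0; b; x).  Splitting off the first term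
   of the series gives the contiguous relation (1 - b) F(b) = (1 - b) + x F(bq),
   and the identity is a formal consequence of it.  Let L_m(a, b) and R_m(a, b)
   be the two sides for alpha = m, a = q^mu, b = q^(mu+beta).  Splitting off the
   term j = 0 gives
     R_(m+1)(a, b) = (aq;q)_m (1 - b q^m) F(aq) - (a;q)_(m+1) F(b q^(m+1))
                     + (1 - b q^m) R_m(aq, b),
   and the contiguous relations at a and at b q^m show that L satisfies the same
   recursion, so induction on alpha applies. *)
From Stdlib Require Import Lra Lia.
Require Import Defs.

Lemma Cexp_plus (z w : C) : Cexp (z + w) = Cexp z * Cexp w.
Proof.
  destruct z as [a b], w as [c d]; unfold Cexp, Cmult; simpl.
  rewrite exp_plus, cos_plus, sin_plus; f_equal; ring.
Qed.

Lemma Rcpow_plus (q : R) (z w : C) : Rcpow q (z + w) = Rcpow q z * Rcpow q w.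
Proof.
  unfold Rcpow; rewrite <- Cexp_plus; f_equal; ring.
Qed.

(** The exponent n ln q is real, so the sine part vanishes and only the real power survives. *)
Lemma Rcpow_INR (q : R) (n : nat) : (0 < q)%R -> Rcpow q (INR n) = (q : C) ^ n.
Proof.
  intros Hq; rewrite <- RtoC_pow.
  unfold Rcpow, Cexp, RtoC, Cmult; simpl.
  replace (INR n * 0 + 0 * ln q)%R with 0%R by ring.
  replace (INR n * ln q - 0 * 0)%R with (INR n * ln q)%R by ring.
  rewrite cos_0, sin_0, <- (Rpower_pow n q Hq); unfold Rpower.
  f_equal; ring.
Qed.

Lemma qpoch_S_l (a q : C) (n : nat) :
  qpoch a q (S n) = (1 - a) * qpoch (a * q) q n.
Proof.
  induction n as [|n IH]; [simpl; ring|].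
  change (qpoch a q (S (S n))) with (qpoch a q (S n) * (1 - a * q ^ S n)).
  rewrite IH; simpl; ring.
Qed.

Lemma qpoch_0_l (q : C) (n : nat) : qpoch 0 q n = 1.
Proof.
  induction n as [|n IH]; simpl; [|rewrite IH]; ring.
Qed.

Lemma qpoch_neq0_factor (b q : C) :
  (forall n, qpoch b q n <> 0) -> forall n, 1 - b * q ^ n <> 0.
Proof.
  intros Hb n H; apply (Hb (S n)); simpl; rewrite H; ring.
Qed.

(** Since (bq;q)_n divides (b;q)_(n+1), the non-vanishing hypothesis survives the shift from b to
    bq. *)
Lemma qpoch_neq0_mul (b q : C) :
  (forall n, qpoch b q n <> 0) -> forall n, qpoch (b * q) q n <> 0.
Proof.
  intros Hb n H; apply (Hb (S n)); rewrite qpoch_S_l, H; ring.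
Qed.

Lemma qpoch_neq0_mul_pow (b q : C) (k : nat) :
  (forall n, qpoch b q n <> 0) -> forall n, qpoch (b * q ^ k) q n <> 0.
Proof.
  revert b; induction k as [|k IH]; intros b Hb.
  - simpl; rewrite Cmult_1_r; exact Hb.
  - rewrite Cpow_S, Cmult_assoc; apply IH, qpoch_neq0_mul, Hb.
Qed.

Lemma qpoch_qq_neq0 (q : R) (n : nat) : (0 < q < 1)%R -> qpoch q q n <> 0.
Proof.
  intros Hq; induction n as [|n IH]; simpl.
  - exact C1_nz.
  - apply Cmult_neq_0; [exact IH|].
    rewrite <- RtoC_pow, <- RtoC_mult, <- RtoC_minus.
    intros H; apply RtoC_inj in H.
    assert (q ^ n <= 1 ^ n)%R by (apply pow_incr; lra).
    rewrite pow1 in *; nra.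
Qed.

Lemma is_lim_seq_Cmod_qfactor (q : R) (b : C) :
  (0 < q < 1)%R -> is_lim_seq (fun n => Cmod (1 - b * (q : C) ^ n)) 1%R.
Proof.
  intros Hq.
  assert (Hg : is_lim_seq (fun n => Cmod b * q ^ n)%R 0%R).
  { replace (Finite 0) with (Rbar_mult (Cmod b) 0%R)
      by (simpl; f_equal; ring).
    apply is_lim_seq_scal_l, is_lim_seq_geom.
    rewrite Rabs_pos_eq; lra. }
  assert (Hm : forall n, Cmod (b * (q : C) ^ n) = (Cmod b * q ^ n)%R).
  { intros n; rewrite Cmod_mult, Cmod_pow, Cmod_R, Rabs_pos_eq; lra. }
  apply is_lim_seq_le_le with (u := fun n => (1 - Cmod b * q ^ n)%R)
                              (w := fun n => (1 + Cmod b * q ^ n)%R).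
  - intros n; rewrite <- Hm; split.
    + pose proof (Cmod_triangle (1 - b * (q : C) ^ n) (b * (q : C) ^ n)) as H.
      replace (1 - b * (q : C) ^ n + b * (q : C) ^ n) with (1 : C) in H by ring.
      rewrite Cmod_1 in H; lra.
    + pose proof (Cmod_triangle 1 (- (b * (q : C) ^ n))) as H.
      rewrite Cmod_1, Cmod_opp in H; exact H.
  - replace (Finite 1) with (Finite (1 - 0)) by (f_equal; ring).
    apply is_lim_seq_minus'; [apply is_lim_seq_const|exact Hg].
  - replace (Finite 1) with (Finite (1 + 0)) by (f_equal; ring).
    apply is_lim_seq_plus'; [apply is_lim_seq_const|exact Hg].
Qed.

(** Ratio test: consecutive coefficients 1/(b;q)_n have ratio 1/(1 - b q^n), whose modulus tends to
    1, so the radius of convergence is 1. *)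
Lemma ex_series_phi (q : R) (b x : C) :
  (0 < q < 1)%R -> Cmod x < 1 -> (forall n, qpoch b q n <> 0) ->
  @ex_series C_AbsRing C_NormedModule (fun n => x ^ n / qpoch b q n).
Proof.
  intros Hq Hx Hb.
  apply @ex_series_le with (V := C_CompleteNormedModule)
    (b := fun n => Rabs (/ Cmod (qpoch b q n) * Cmod x ^ n)).
  - intros n; change (Cmod (x ^ n / qpoch b q n)
                      <= Rabs (/ Cmod (qpoch b q n) * Cmod x ^ n)).
    unfold Cdiv; rewrite Cmod_mult, Cmod_inv, Cmod_pow, Rmult_comm by apply Hb.
    apply Rle_abs.
  - assert (Hpos : forall n, (0 < Cmod (qpoch b q n))%R)
      by (intros n; apply Cmod_gt_0, Hb).
    assert (Hfac : forall n, (0 < Cmod (1 - b * (q : C) ^ n))%R)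
      by (intros n; apply Cmod_gt_0, qpoch_neq0_factor, Hb).
    apply (CV_disk_DAlembert (fun n => / Cmod (qpoch b q n))%R (Cmod x) 1).
    + intros n; apply Rinv_neq_0_compat, Rgt_not_eq, Hpos.
    + apply is_lim_seq_ext with (fun n => / Cmod (1 - b * (q : C) ^ n))%R.
      { intros n; simpl; rewrite Cmod_mult.
        pose proof (Hpos n); pose proof (Hfac n).
        rewrite Rabs_pos_eq.
        - field; lra.
        - apply Rlt_le, Rdiv_lt_0_compat; apply Rinv_0_lt_compat; [nra|lra]. }
      replace (Finite 1) with (Rbar_inv 1%R) by (simpl; f_equal; field).
      apply is_lim_seq_inv; [apply is_lim_seq_Cmod_qfactor, Hq|].
      intros H; injection H; lra.
    + right; split; [lra|].
      rewrite Rinv_1, Rabs_pos_eq; [exact Hx|apply Cmod_ge_0].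
Qed.

(** In the summand (q;q)_n cancels and (0;q)_n = 1. *)
Lemma phi21_is_series (q : R) (b x l : C) :
  (0 < q < 1)%R -> (forall n, qpoch b q n <> 0) ->
  @is_series C_AbsRing C_NormedModule (fun n => x ^ n / qpoch b q n) l ->
  phi21 q q 0 b x = l.
Proof.
  intros Hq Hb H; apply is_CSeries_unique.
  apply is_series_ext with (2 := H); intros n.
  rewrite qpoch_0_l; match goal with |- ?u = ?v => change (@eq C u v) end.
  field; split; [apply qpoch_qq_neq0, Hq|apply Hb].
Qed.

(** Because (b;q)_(n+1) = (1 - b) (bq;q)_n, the series at b without its first term 1 is x/(1 - b)
    times the series at bq. *)
Lemma phi21_contiguous (q : R) (b x : C) :
  (0 < q < 1)%R -> Cmod x < 1 -> (forall n, qpoch b q n <> 0) ->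
  (1 - b) * phi21 q q 0 b x = (1 - b) + x * phi21 q q 0 (b * q) x.
Proof.
  intros Hq Hx Hb.
  assert (Hbq : forall n, qpoch (b * q) q n <> 0)
    by (apply qpoch_neq0_mul, Hb).
  assert (H1b : 1 - b <> 0).
  { replace b with (b * (q : C) ^ 0) by (simpl; ring).
    apply qpoch_neq0_factor, Hb. }
  destruct (ex_series_phi q (b * q) x Hq Hx Hbq) as [l Hl].
  rewrite (phi21_is_series q (b * q) x l Hq Hbq Hl).
  rewrite (phi21_is_series q b x (1 + x / (1 - b) * l) Hq Hb).
  - field; exact H1b.
  - apply is_series_decr_1.
    match goal with |- is_series _ ?v => replace v with (x / (1 - b) * l) end;
      [|unfold plus, opp; simpl; field; exact H1b].
    apply is_series_ext with
      (fun n => @scal C_AbsRing C_NormedModule (x / (1 - b))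
                  (x ^ n / qpoch (b * q) q n)).
    + intros n; rewrite qpoch_S_l, Cpow_S; unfold scal; simpl; unfold mult; simpl.
      match goal with |- ?u = ?v => change (@eq C u v) end.
      field; split; [apply Hbq|exact H1b].
    + apply (is_series_scal (x / (1 - b)) _ _ Hl).
Qed.

(* [sum_Sn_m] and [sum_n_mult_l] with the operations of [C] in place of the
   [plus] and [mult] of the algebraic hierarchy. *)
Lemma C_sum_n_S_l (f : nat -> C) (m : nat) :
  sum_n f (S m) = f O + sum_n (fun j => f (S j)) m.
Proof.
  unfold sum_n; rewrite sum_Sn_m by lia; now rewrite <- sum_n_m_S.
Qed.

Lemma C_sum_n_mult_l (c : C) (f : nat -> C) (m : nat) :
  sum_n (fun j => c * f j) m = c * sum_n f m.
Proof.
  exact (sum_n_mult_l (K := C_Ring) c f m).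
Qed.

(** Purely algebraic form of the identity, with m = alpha - 1. The induction keeps [a] and [b]
    general, since its hypothesis is applied at (aq, b). *)
Lemma contiguous_identity (q x : C) (F : C -> C) :
  (forall b, (forall n, qpoch b q n <> 0) ->
     (1 - b) * F b = (1 - b) + x * F (b * q)) ->
  forall (m : nat) (a b : C),
    (forall n, qpoch a q n <> 0) -> (forall n, qpoch b q n <> 0) ->
    qpoch b q (S m) * F (a * q ^ S m) * F b
      - qpoch a q (S m) * F a * F (b * q ^ S m)
    = sum_n (fun j =>
        qpoch (a * q ^ S j) q (m - j) * qpoch (b * q ^ (m - j)) q (S j)
          * F (a * q ^ S j)
        - qpoch (a * q ^ j) q (S m - j) * qpoch (b * q ^ (S m - j)) q j
          * F (b * q ^ (S m - j))) m.
Proof.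
  intros HF; induction m as [|m IH]; intros a b Ha Hb.
  - rewrite sum_O; simpl; rewrite !Cmult_1_r.
    transitivity (((1 - b) * F b) * F (a * q) - ((1 - a) * F a) * F (b * q));
      [ring|].
    rewrite (HF a Ha), (HF b Hb); ring.
  - assert (Haq : forall n, qpoch (a * q) q n <> 0)
      by (apply qpoch_neq0_mul, Ha).
    (* Here alpha = m + 2, so the second contiguous relation is taken at b q^(m+1). *)
    assert (Hrec := HF _ (qpoch_neq0_mul_pow b q (S m) Hb)).
    rewrite C_sum_n_S_l.
    (* After the index shift, 1 - b q^(m+1) is the last factor of both factorials based at powers of
       q times b, whatever j is; pulling it out leaves the sum for (aq, b). *)
    rewrite (sum_n_ext_loc _ (fun j => (1 - b * q ^ S m) *
      (qpoch (a * q * q ^ S j) q (m - j) * qpoch (b * q ^ (m - j)) q (S j)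
         * F (a * q * q ^ S j)
       - qpoch (a * q * q ^ j) q (S m - j) * qpoch (b * q ^ (S m - j)) q j
         * F (b * q ^ (S m - j))))).
    + rewrite C_sum_n_mult_l.
      rewrite <- (IH (a * q) b Haq Hb).
      rewrite (qpoch_S_l a), Cpow_S, Cmult_assoc.
      transitivity (qpoch b q (S (S m)) * F (a * q * q ^ S m) * F b
        - qpoch (a * q) q (S m) * ((1 - a) * F a) * F (b * q ^ S (S m))); [simpl; ring|].
      rewrite (HF a Ha).
      change (qpoch b q (S (S m))) with (qpoch b q (S m) * (1 - b * q ^ S m)).
      (* The relation at b q^(m+1) trades x F(b q^(m+2)) for (1 - b q^(m+1)) (F(b q^(m+1)) - 1). The
         F part completes the left side for (aq, b); the rest, with the (1 - a) term, is the j = 0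
         summand. *)
      transitivity ((1 - b * q ^ S m) * (qpoch b q (S m) * F (a * q * q ^ S m) * F b)
        - qpoch (a * q) q (S m) * F (a * q) * ((1 - b * q ^ S m) * F (b * q ^ S m))
        + qpoch (a * q) q (S m) * (1 - b * q ^ S m) * F (a * q)
        - qpoch (a * q) q (S m) * (1 - a) * F (b * q ^ S (S m))).
      * rewrite Hrec.
        replace (b * q ^ S m * q) with (b * q ^ S (S m)) by (simpl; ring).
        ring.
      * rewrite !Nat.sub_0_r, Cpow_1_r.
        replace (a * q ^ 0) with a by (simpl; ring).
        rewrite (qpoch_S_l a).
        change (qpoch (b * q ^ S m) q 1) with (1 * (1 - b * q ^ S m * q ^ 0)).
        change (qpoch (b * q ^ S (S m)) q 0) with (1 : C).
        change (q ^ 0) with (1 : C).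
        ring.
    + intros j Hj.
      match goal with |- ?u = ?v => change (@eq C u v) end.
      change (S m - S j)%nat with (m - j)%nat.
      change (S (S m) - S j)%nat with (S m - j)%nat.
      rewrite <- !(Cmult_assoc a), <- !Cpow_S.
      change (qpoch (b * q ^ (m - j)) q (S (S j)))
        with (qpoch (b * q ^ (m - j)) q (S j) * (1 - b * q ^ (m - j) * q ^ S j)).
      change (qpoch (b * q ^ (S m - j)) q (S j))
        with (qpoch (b * q ^ (S m - j)) q j * (1 - b * q ^ (S m - j) * q ^ j)).
      rewrite <- !(Cmult_assoc b), <- !Cpow_add_r.
      replace (m - j + S j)%nat with (S m) by lia.
      replace (S m - j + j)%nat with (S m) by lia.
      ring.
Qed.

Theorem theorem4 :
  forall (q : R) (alpha : nat) (mu beta x : C),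
    (0 < q < 1)%R ->
    (1 <= alpha)%nat ->
    Cmod x < 1 ->
    (forall n : nat, qpoch (Rcpow q mu) q n <> 0) ->
    (forall n : nat, qpoch (Rcpow q (mu + beta)) q n <> 0) ->
    qpoch (Rcpow q (mu + beta)) q alpha
      * phi21 q q 0 (Rcpow q (mu + INR alpha)) x
      * phi21 q q 0 (Rcpow q (mu + beta)) x
    - qpoch (Rcpow q mu) q alpha
      * phi21 q q 0 (Rcpow q mu) x
      * phi21 q q 0 (Rcpow q (mu + INR alpha + beta)) x
    = sum_n (fun j : nat =>
        qpoch (Rcpow q (mu + 1 + INR j)) q (alpha - 1 - j)
          * qpoch (Rcpow q (mu + INR alpha + beta - 1 - INR j)) q (1 + j)
          * phi21 q q 0 (Rcpow q (mu + 1 + INR j)) x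
        - qpoch (Rcpow q (mu + INR j)) q (alpha - j)
          * qpoch (Rcpow q (mu + INR alpha + beta - INR j)) q j
          * phi21 q q 0 (Rcpow q (mu + INR alpha + beta - INR j)) x)
      (alpha - 1).
Proof.
  intros q alpha mu beta x Hq Halpha Hx Ha Hb.
  destruct alpha as [|m]; [lia|].
  assert (Hshift : forall (z : C) (n : nat),
            Rcpow q (z + INR n) = Rcpow q z * (q : C) ^ n)
    by (intros z n; rewrite Rcpow_plus, Rcpow_INR; [reflexivity|lra]).
  replace (mu + INR (S m) + beta) with (mu + beta + INR (S m)) by ring.
  rewrite !Hshift, (contiguous_identity q x (fun b => phi21 q q 0 b x)
    (fun b => phi21_contiguous q b x Hq Hx) m _ _ Ha Hb).
  replace (S m - 1)%nat with m by lia.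
  apply sum_n_ext_loc; intros j Hj.
  (* The complex exponents become mu or mu + beta plus a natural number; the subtractions are not
     truncated because j <= m. *)
  assert (Hm1 : mu + 1 + INR j = mu + INR (S j))
    by (rewrite S_INR, RtoC_plus; ring).
  assert (Hb1 : mu + beta + INR (S m) - 1 - INR j = mu + beta + INR (m - j))
    by (rewrite S_INR, minus_INR, RtoC_plus, RtoC_minus by exact Hj; ring).
  assert (Hb0 : mu + beta + INR (S m) - INR j = mu + beta + INR (S m - j))
    by (rewrite minus_INR, RtoC_minus by lia; ring).
  now rewrite Hm1, Hb1, Hb0, !Hshift.
Qed.
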